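(* As $n\to\infty$, $$p(3,n)\le \frac{11}{432}\,n^{-3/2}\exp\left(\pi\sqrt{\frac{11n}{3}}\right)(1+o(1)).$$ In particular, $$p(3,n)\le \exp\left(\pi\sqrt{\frac{11n}{3}}+o(\sqrt n)\right)\quad\text{as } n\to\infty.$$
   Context: For positive integers $m,n$, let $R=[0,m]\times[0,n]\subset\mathbb{R}^2$. All rectangles have sides parallel to the coordinate axes. A partition of the rectangle $R$ is a multiset of rectangles $\{R_i\}_{i\in I}$ such that: (1) each $R_i$ has positive integer side lengths; (2) rectangles of sizes $k\times l$ and $l\times k$ are regarded as indistinguishable; (3) all the rectangles of the multiset can be arranged so that they cover exactly $R$ and their interiors are pairwise disjoint. Two partitions are the same if they are equal as multisets (of rectangle types, up to rotation); the geometric arrangement is irrelevant. $p(m,n)$ denotes the number of partitions of the $m\times n$ rectangle. *)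

(* Defs.v *)
From mathcomp Require Import all_boot all_order all_algebra.
From mathcomp Require Import finmap multiset.
From mathcomp Require Import all_classical all_reals all_analysis.
Import numFieldNormedType.Exports.

Set Implicit Arguments.
Unset Strict Implicit.
Unset Printing Implicit Defensive.

Local Open Scope classical_set_scope.
Local Open Scope ring_scope.

(* The closed rectangle with lower left corner [c], width [d.1], height [d.2]. *)
Definition rect (R : realType) (c : R * R) (d : nat * nat) : set (R * R) :=
  `[c.1, c.1 + d.1%:R] `*` `[c.2, c.2 + d.2%:R].

(* Size up to rotation: the sorted pair of side lengths represents the
   unordered pair. *)
Definition rect_type (d : nat * nat) : nat * nat :=
  (minn d.1 d.2, maxn d.1 d.2).

(* Corners of the rectangles are arbitrary real points; only the side lengths
   are required to be integers. A rotated copy of a [k] x [l] rectangle is one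
   placed with dimensions [(l, k)]. *)
Definition is_tiling (R : realType) (m n N : nat)
    (c : 'I_N -> R * R) (d : 'I_N -> nat * nat) : Prop :=
  [/\ forall i, (0 < (d i).1)%N /\ (0 < (d i).2)%N,
      \bigcup_i rect (c i) (d i) = rect (0, 0) (m, n)
    & trivIset setT (fun i => interior (rect (c i) (d i)))].

Definition is_partition (R : realType) (m n : nat) (M : {mset nat * nat}%mset) :
    Prop :=
  exists (N : nat) (c : 'I_N -> R * R) (d : 'I_N -> nat * nat),
    is_tiling m n c d /\ M = seq_mset [seq rect_type (d i) | i <- enum 'I_N].

(* [fset_set] returns the empty set on an infinite set, but there are only
   finitely many partitions: the interior of a rectangle with sides at least 1
   contains a point of (1/2)Z x (1/2)Z, so a tiling has at most
   (2m + 1)(2n + 1) rectangles, of sides at most [maxn m n]. *)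
Definition num_partitions (R : realType) (m n : nat) : nat :=
  #|` fset_set [set M | is_partition R m n M] |.

(* Main.v *)
Require Import Defs.
From mathcomp Require Import all_boot all_order all_algebra.
From mathcomp Require Import finmap multiset.
From mathcomp Require Import all_classical all_reals all_analysis.
From mathcomp Require Import ring lra zify.
Import Order.TTheory GRing.Theory Num.Theory.
Import numFieldNormedType.Exports.

Local Open Scope classical_set_scope.
Local Open Scope ring_scope.

(** A partition of the 3 x n rectangle is a multiset of types (a, b) with
    a <= 3 and a <= b whose areas add up to at most 3 n (partition_seq), and it
    suffices to count these multisets.  For 0 < q < 1 each of them has weight
    q^area >= q^(3 n), so
      p(3, n) <= q^(- 3 n) * the product of 1 / (1 - q^(a b)) over all types
    (num_partitions_le_prod).  If P(q) is the product of 1 / (1 - q^k), the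
    product over the types is
      (1 - q^2) (1 - q^3) (1 - q^6) P(q) P(q^2) P(q^3),
    because (2, 1), (3, 1) and (3, 2) are the same types as (1, 2), (1, 3)
    and (2, 3).

    Put q = e^(-t).  The three factors in front are at most 36 t^3, and
    P(e^(-t)) <= exp (pi^2 / (6 t)), since 1 / (e^x - 1) <= 1 / x and the
    sum of 1 / m^2 is at most pi^2 / 6 (sum_inv_sqr_le).  At the optimal
    t = 11 pi / (18 s), with s = sqrt (11 n / 3), the exponentials combine to
    exp (pi s) and t^3 is of order n^(-3/2).  So already the shape of the
    bound appears without the Gaussian factor of a saddle point argument,
    only with a worse constant.

    The constant is repaired by the next term of P: for x <= 1 the inequality
    1 / (e^x - 1) <= 1 / x can be improved by 1 / 5, which divides the bound
    for P(e^(-t)) by exp (H / 5), where H is the harmonic sum up to any M0 with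
    M0 t <= 1 (euler_product_le).  As t tends to 0 this H is unbounded, so
    eventually any constant is gained, in particular 11 / 432.  Hence both
    error terms of the theorem can be taken to be 0. *)

(** * Euler's bound for the sum of inverse squares *)

Lemma sin_le_id (R : realType) (x : R) : 0 <= x -> sin x <= x.
Proof.
move=> x0.
have cs : {within `[0, x], continuous (@sin R)}.
  by apply: continuous_subspaceT => y; exact: continuous_sin.
have [c _] := MVT_segment x0 (fun y _ => is_derive_sin y) cs.
rewrite sin0 !subr0 => ->.
by rewrite ler_piMl// cos_le1.
Qed.

(** Since sin (pi / 2 - y) = cos y, this is cos^2 + sin^2 = 1 divided by
    (sin y cos y)^2 = sin^2 (2 y) / 4. *)
Lemma inv_sin2_double (R : realType) (y : R) : 0 < y < pi / 2 ->
  (sin y ^+ 2)^-1 + (sin (pi / 2 - y) ^+ 2)^-1 = 4 * (sin (2 * y) ^+ 2)^-1.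
Proof.
move=> /andP[y0 y2].
have s0 : 0 < sin y by apply: sin_gt0_pihalf; rewrite y0.
have c0 : 0 < cos y by apply: cos_gt0_pihalf; rewrite y2 andbT; lra.
have -> : sin (pi / 2 - y) = cos y by rewrite addrC sinDpihalf cosN.
have -> : sin (2 * y) = 2 * (cos y * sin y) by rewrite mulr_natl sin_mulr2n mulr_natl.
have := cos2Dsin2 y; move: (sin y) (cos y) s0 c0 => s c s0 c0 e.
have -> : (s ^+ 2)^-1 + (c ^+ 2)^-1 = (c ^+ 2 + s ^+ 2) / (s ^+ 2 * c ^+ 2).
  by field; rewrite !gt_eqF.
by rewrite e; field; rewrite !gt_eqF.
Qed.

(** Halving the angles quadruples the sum: the 2^n angles at level n split, by
    inv_sin2_double, into the 2^(n+1) angles at level n + 1, where the index k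
    of y is paired with the index 2^(n+1) - 1 - k of pi / 2 - y. *)
Lemma sum_inv_sin2_odd (R : realType) (n : nat) :
  \sum_(0 <= k < 2 ^ n) (sin ((2 * k + 1)%:R * pi / (2 ^ n.+2)%:R) ^+ 2)^-1
    = 2 * 4 ^+ n :> R.
Proof.
elim: n => [|n IH].
  rewrite expn0 big_nat1 expr0 mulr1 muln0 add0n mul1r.
  have p0 := pi_gt0 R.
  have := @inv_sin2_double R (pi / 4).
  have -> : pi / 2 - pi / 4 = pi / 4 :> R by field.
  have -> : 2 * (pi / 4) = pi / 2 :> R by field.
  rewrite sin_pihalf expr1n invr1 => H.
  have {}H := H ltac:(lra).
  by rewrite [(2 ^ 2)%N]/=; lra.
rewrite expnS mul2n -addnn (@big_cat_nat _ _ _ (2 ^ n)) ?leq_addr//=.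
have shift (F : nat -> R) : \sum_(2 ^ n <= k < 2 ^ n + 2 ^ n) F k =
    \sum_(0 <= k < 2 ^ n) F (k + 2 ^ n)%N.
  by rewrite -{1}[(2 ^ n)%N]add0n big_addn addnK.
rewrite [X in _ + X]big_nat_rev/= shift.
rewrite -big_split/= exprS mulrCA -IH mulr_sumr.
apply: eq_big_nat => k /andP[_ kn].
have p0 := pi_gt0 R.
have N0 : 0 < (2 ^ n)%:R :> R by rewrite ltr0n expn_gt0.
have k0 : 0 <= k%:R :> R by [].
have kN : k%:R + 1 <= (2 ^ n)%:R :> R by rewrite natr1 ler_nat.
rewrite [(2 * (2 ^ n + _ - _) + 1)%N](_ : _ = 2 ^ n.+2 - (2 * k + 1))%N; last first.
  by rewrite !expnS; lia.
rewrite natrB; last by rewrite !expnS; lia.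
set y := _%:R * pi / (2 ^ n.+3)%:R.
have -> : ((2 ^ n.+2)%:R - (2 * k + 1)%:R) * pi / (2 ^ n.+3)%:R = pi / 2 - y.
  rewrite /y mulrBl mulrBl; congr (_ - _).
  rewrite (expnS 2 n.+2) natrM; move: (2 ^ n.+2)%N (expn_gt0 2 n.+2) => q q0.
  by field; rewrite pnatr_eq0 -lt0n.
rewrite inv_sin2_double.
  congr (4 * (sin _ ^+ 2)^-1); rewrite /y (expnS 2 n.+2) natrM.
  move: (2 ^ n.+2)%N (expn_gt0 2 n.+2) => q q0.
  by field; rewrite pnatr_eq0 -lt0n.
rewrite /y !expnS !natrM natrD natrM; apply/andP; split.
  by rewrite divr_gt0 ?mulr_gt0// ltr_wpDl// mulr_ge0.
rewrite ltr_pdivrMr ?mulr_gt0//.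
rewrite [ltRHS](_ : _ = 4 * (2 ^ n)%:R * pi); last by field.
by rewrite ltr_pM2r//; lra.
Qed.

(** Replace sin x by the larger x in sum_inv_sin2_odd; enlarging the number of
    terms to a power of two is harmless since the terms are nonnegative. *)
Lemma sum_inv_odd_sqr_le (R : realType) (M : nat) :
  \sum_(0 <= k < M) ((2 * k + 1)%:R ^+ 2)^-1 <= pi ^+ 2 / 8 :> R.
Proof.
have p0 := pi_gt0 R.
apply: (@le_trans _ _ (\sum_(0 <= k < 2 ^ M) ((2 * k + 1)%:R ^+ 2)^-1)).
  rewrite (@big_cat_nat _ _ _ M _ (2 ^ M))//= ?(ltnW (ltn_expl _ _))//.
  by rewrite lerDl sumr_ge0// => i _; rewrite invr_ge0 exprn_ge0.
have -> : pi ^+ 2 / 8 = pi ^+ 2 / 4 ^+ M.+2 * (2 * 4 ^+ M) :> R.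
  by rewrite !exprS; field; rewrite gt_eqF// exprn_gt0.
rewrite -sum_inv_sin2_odd mulr_sumr.
rewrite big_nat [leRHS]big_nat; apply: ler_sum => k /andP[_ kM].
set x := _%:R * pi / _.
have N0 : 0 < (2 ^ M.+2)%:R :> R by rewrite ltr0n expn_gt0.
have k0 : 0 < (2 * k + 1)%:R :> R by rewrite ltr0n addn1.
have x0 : 0 < x by rewrite divr_gt0// mulr_gt0.
have s0 : 0 < sin x.
  apply: sin_gt0_pihalf; rewrite x0/= /x ltr_pdivrMr//.
  rewrite [ltRHS](_ : _ = (2 ^ M.+1)%:R * pi); last first.
    by rewrite (expnS 2 M.+1) natrM; field.
  by rewrite ltr_pM2r// ltr_nat expnS; lia.
have -> : ((2 * k + 1)%:R ^+ 2)^-1 = pi ^+ 2 / 4 ^+ M.+2 * (x ^+ 2)^-1.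
  have key (a b q : R) : 0 < a -> 0 < b -> 0 < q ->
      (a ^+ 2)^-1 = b ^+ 2 / q ^+ 2 * ((a * b / q) ^+ 2)^-1.
    by move=> a0 b0 q0; field; rewrite !gt_eqF.
  have -> : (4 ^+ M.+2 : R) = (2 ^ M.+2)%:R ^+ 2.
    by rewrite natrX -exprM mulnC exprM -[in RHS]natrX.
  exact: key.
rewrite ler_pM2l ?divr_gt0 ?exprn_gt0//.
rewrite lef_pV2 ?posrE ?exprn_gt0// ler_pXn2r ?nnegrE ?(ltW s0) ?(ltW x0)//.
by rewrite sin_le_id// ltW.
Qed.

(** The half of Euler's evaluation of zeta(2) that an upper bound requires.
    If S M is the sum, the even terms of S (2 M) contribute S M / 4 and the odd
    ones at most pi^2 / 8, so S M <= S (2 M) <= pi^2 / 8 + S M / 4. *)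
Lemma sum_inv_sqr_le (R : realType) (M : nat) :
  \sum_(0 <= m < M) (m.+1%:R ^+ 2)^-1 <= pi ^+ 2 / 6 :> R.
Proof.
set S := fun M => \sum_(0 <= m < M) (m.+1%:R ^+ 2)^-1 : R.
have split_odd N : S (2 * N)%N =
    \sum_(0 <= k < N) ((2 * k + 1)%:R ^+ 2)^-1 + S N / 4.
  rewrite /S; elim: N => [|N IH]; first by rewrite muln0 !big_nil mul0r addr0.
  rewrite mulnS !addSn add0n !big_nat_recr//= IH mulrDl addrACA -!addrA.
  congr (_ + (_ + (_ + _))); first by rewrite addn1.
  have -> : (2 * N).+2 = (2 * N.+1)%N by lia.
  by rewrite natrM; field; rewrite addrC natr1 pnatr_eq0.
have mono : S M <= S (2 * M)%N.
  rewrite /S [leRHS](@big_cat_nat _ _ _ M)//= ?leq_pmull//.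
  by rewrite lerDl sumr_ge0// => i _; rewrite invr_ge0 exprn_ge0.
have := split_odd M; have := sum_inv_odd_sqr_le R M.
rewrite -/(S M); lra.
Qed.

(** * Upper bound for the partition generating function near 1 *)

Lemma sum_geometric_le (R : realFieldType) (x : R) (n : nat) :
  0 <= x < 1 -> \sum_(i < n) x ^+ i <= (1 - x)^-1.
Proof.
move=> /andP[x0 x1].
have x1' : 0 < 1 - x by rewrite subr_gt0.
rewrite -[leRHS]mul1r ler_pdivlMr// -opprB mulrN mulrC -subrX1 opprB.
by rewrite lerBlDr lerDl exprn_ge0.
Qed.

Lemma geometric_tail_le (R : realFieldType) (x : R) (n : nat) :
  0 <= x < 1 -> \sum_(i < n) x ^+ i.+1 <= x / (1 - x).
Proof.
move=> x01; under eq_bigr do rewrite exprS.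
by rewrite -mulr_sumr ler_wpM2l ?sum_geometric_le//; case/andP: x01.
Qed.

(** The difference of the two sides without the last term has derivative
    - y^M / (1 - y), which the mean value theorem controls. *)
Lemma oppr_ln_le_taylor (R : realType) (x : R) (M : nat) : 0 <= x < 1 ->
  - ln (1 - x) <= \sum_(i < M) x ^+ i.+1 / i.+1%:R + x ^+ M / (1 - x).
Proof.
move=> /andP[x0 x1].
pose g (y : R) : R := ln (1 - y) + \sum_(i < M) y ^+ i.+1 / i.+1%:R.
pose dg (y : R) : R := - (y ^+ M / (1 - y)).
have g' (y : R) : y < 1 -> is_derive y 1 g (dg y).
  move=> y1; have y1' : 0 < 1 - y by rewrite subr_gt0.
  have d1 : is_derive y (1 : R) (fun z : R => ln (1 - z)) (- (1 - y)^-1).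
    have dl := is_derive1_ln y1'.
    have di : is_derive y (1 : R) (fun z : R => 1 - z) (- 1).
      by apply: is_derive_eq; rewrite add0r mul1r.
    have := @is_derive1_comp R (@ln R) (fun z => 1 - z) y _ _ dl di.
    by rewrite mulrN1.
  have d2 (i : nat) : is_derive y (1 : R) (fun z : R => z ^+ i.+1 / i.+1%:R) (y ^+ i).
    have -> : (fun z : R => z ^+ i.+1 / i.+1%:R) = i.+1%:R^-1 *: (id ^+ i.+1).
      by apply/funext => z; rewrite exprfctE mulrC.
    apply: is_derive_eq.
    rewrite /GRing.scale/= mulr1 mulrA mulVf ?pnatr_eq0//.
    by rewrite mul1r.
  have d3 : is_derive y (1 : R) (fun z : R => \sum_(i < M) z ^+ i.+1 / i.+1%:R)
      (\sum_(i < M) y ^+ i).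
    rewrite -fct_sumE; exact: is_derive_sum.
  apply: is_derive_eq.
  rewrite /dg; apply: (mulfI (negbT (gt_eqF y1'))).
  have geom : (1 - y) * \sum_(i < M) y ^+ i = 1 - y ^+ M.
    by have := subrX1 y M; lra.
  by rewrite mulrDr geom; field; rewrite gt_eqF.
have cg : {within `[0, x], continuous g}.
  apply: derivable_within_continuous => y; rewrite in_itv/= => /andP[_ yx].
  by case: (g' y (le_lt_trans yx x1)).
have dgx y : y \in `]0, x[ -> is_derive y 1 g (dg y).
  by rewrite in_itv/= => /andP[_ yx]; apply: g'; exact: lt_trans x1.
have [c] := MVT_segment x0 dgx cg.
rewrite in_itv/= => /andP[c0 cx].
rewrite {2}/g subr0 ln1 add0r big1 ?subr0; last first.
  by move=> i _; rewrite expr0n mul0r.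
rewrite /g /dg => e.
suff : c ^+ M / (1 - c) * x <= x ^+ M / (1 - x) by move: e; lra.
have x1' : 0 < 1 - x by rewrite subr_gt0.
have c1' : 0 < 1 - c by lra.
apply: (@le_trans _ _ (c ^+ M / (1 - c))).
  by rewrite ler_piMr ?(ltW x1)// divr_ge0 ?exprn_ge0// ltW.
apply: ler_pM.
- by rewrite exprn_ge0.
- by rewrite invr_ge0 ltW.
- by apply: lerXn2r; rewrite ?nnegrE.
- by rewrite lef_pV2 ?posrE; lra.
Qed.

(** The left-hand side is 1 / (e^y - 1) and e^y >= (1 + y / 2)^2, so it is at
    most 1 / (y + y^2 / 4) = 1 / y - 1 / (4 + y).  The constant saved for small y
    is what makes the Euler product smaller than exp (pi^2 / (6 t)) by an
    arbitrarily large factor. *)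
Lemma expR_ratio_le (R : realType) (y : R) : 0 < y ->
  expR (- y) / (1 - expR (- y)) <= y^-1 - (y <= 1)%R%:R / 5.
Proof.
move=> y0.
have e1 : 1 + y + y ^+ 2 / 4 <= expR y.
  have -> : 1 + y + y ^+ 2 / 4 = (1 + y / 2) ^+ 2 by field.
  have -> : expR y = expR (y / 2) ^+ 2.
    by rewrite -expRM_natl; congr expR; field.
  by apply: lerXn2r; rewrite ?nnegrE ?expR_ge0 ?expR_ge1Dx//; lra.
have -> : expR (- y) / (1 - expR (- y)) = (expR y - 1)^-1.
  have e0 : expR y - 1 != 0 by rewrite gt_eqF//; nra.
  rewrite expRN; move: (expR y) (expR_gt0 y) e0 => z z0 z1.
  by field; rewrite z1 gt_eqF.
apply: (@le_trans _ _ (y + y ^+ 2 / 4)^-1).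
  by rewrite lef_pV2 ?posrE; nra.
have [y1|y1] := leP y 1; rewrite /= ?mul0r ?subr0.
  rewrite -subr_ge0.
  have -> : y^-1 - 1%:R / 5 - (y + y ^+ 2 / 4)^-1 = (1 - y) / (5 * (4 + y)).
    by field; apply/and3P; split; rewrite gt_eqF//; nra.
  by rewrite divr_ge0//; lra.
by rewrite lef_pV2 ?posrE; nra.
Qed.

(** With q = e^(-t), the logarithm of the product is the double sum of
    q^(k m) / m over k <= K and m >= 1.  Summing over k first bounds the m-th
    part by (1 / m) / (e^(m t) - 1), hence by 1 / (m^2 t) and, when m t <= 1,
    by 1 / (m^2 t) - 1 / (5 m).  The first terms add up to at most
    pi^2 / (6 t), the corrections to a harmonic sum. *)
Lemma euler_product_le (R : realType) (t : R) (M0 K : nat) :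
  0 < t -> M0%:R * t <= 1 ->
  \prod_(k < K) (1 - expR (- (t * k.+1%:R)))^-1
    <= expR (pi ^+ 2 / (6 * t) - (\sum_(0 <= m < M0) m.+1%:R^-1) / 5).
Proof.
move=> t0 tM0.
pose x (k : nat) : R := expR (- (t * k.+1%:R)).
have x01 k : 0 <= x k < 1.
  by rewrite expR_ge0 expR_lt1 oppr_lt0 mulr_gt0.
have x1 k : 0 < 1 - x k by rewrite subr_gt0; case/andP: (x01 k).
have prodE : \prod_(k < K) (1 - x k)^-1 = expR (\sum_(k < K) - ln (1 - x k)).
  rewrite expR_sum; apply: eq_bigr => k _.
  by rewrite expRN lnK ?posrE.
rewrite -/(x _) prodE ler_expR.
have main M : (M0 <= M)%N ->
    \sum_(k < K) \sum_(m < M) x k ^+ m.+1 / m.+1%:R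
      <= pi ^+ 2 / (6 * t) - (\sum_(0 <= m < M0) m.+1%:R^-1) / 5.
  move=> M0M; rewrite exchange_big/=.
  have bound (m : 'I_M) : \sum_(k < K) x k ^+ m.+1 / m.+1%:R
      <= t^-1 * (m.+1%:R ^+ 2)^-1 - (m < M0)%N%:R * m.+1%:R^-1 / 5.
    rewrite -mulr_suml ler_pdivrMr//.
    set y := m.+1%:R * t.
    have y0 : 0 < y by rewrite mulr_gt0.
    have y01 : 0 <= expR (- y) < 1 by rewrite expR_ge0 expR_lt1 oppr_lt0.
    rewrite (eq_bigr (fun k : 'I_K => expR (- y) ^+ k.+1)); last first.
      move=> k _; rewrite /x -!expRM_natl; congr expR.
      by rewrite /y; ring.
    apply: (le_trans (geometric_tail_le _ _ K y01)).
    apply: (le_trans (expR_ratio_le _ _ y0)).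
    rewrite mulrBl [X in X - _ <= _](_ : _ = t^-1 * (m.+1%:R ^+ 2)^-1 * m.+1%:R); last first.
      have key (a b : R) : 0 < a -> 0 < b ->
          (a * b)^-1 = b^-1 * (a ^+ 2)^-1 * a.
        by move=> a0 b0; field; rewrite !gt_eqF.
      exact: key.
    rewrite lerD2l lerN2 mulrAC mulfVK ?pnatr_eq0//.
    rewrite ler_pM2r// ler_nat; case: ltnP => // mM0.
    rewrite lt0b; apply: le_trans tM0.
    by rewrite /y ler_pM2r// ler_nat.
  apply: le_trans (ler_sum _ (fun m _ => bound m)) _.
  rewrite sumrB -mulr_sumr -mulr_suml; apply: lerB.
    have -> : pi ^+ 2 / (6 * t) = t^-1 * (pi ^+ 2 / 6) :> R.
      by field; rewrite gt_eqF.
    rewrite ler_pM2l ?invr_gt0//.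
    by have := sum_inv_sqr_le R M; rewrite big_mkord.
  rewrite ler_pM2r// -(big_mkord xpredT (fun m => (m < M0)%N%:R * m.+1%:R^-1)).
  rewrite [leRHS](@big_cat_nat _ _ _ M0)//= ler_wpDr//.
    by apply: sumr_ge0 => m _; rewrite mulr_ge0 ?invr_ge0.
  by rewrite big_nat [leRHS]big_nat; apply: ler_sum => m /= ->; rewrite mul1r.
(* Cut the Taylor series at an M for which the K remainders x^M / (1 - x), each
   at most q^M / (1 - q), add up to at most e. *)
pose q := expR (- t) : R.
have q01 : 0 <= q < 1 by rewrite expR_ge0 expR_lt1 oppr_lt0.
apply/ler_addgt0Pl => e e0.
have q1 : 0 < 1 - q by rewrite subr_gt0; case/andP: q01.
have [M M0M qM] : exists2 M, (M0 <= M)%N & K%:R * (q ^+ M / (1 - q)) <= e.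
  pose a := e * (1 - q) / K.+1%:R.
  have a0 : 0 < a by rewrite divr_gt0 ?mulr_gt0.
  have /cvgrPdist_le/(_ a a0)[M1 _ qM1] : (GRing.exp q : R ^nat) @ \oo --> 0.
    by apply: cvg_expr; case/andP: q01 => ? ?; rewrite ger0_norm.
  exists (maxn M0 M1); first exact: leq_maxl.
  have := qM1 _ (leq_maxr M0 M1); rewrite /= sub0r normrN.
  rewrite ger0_norm ?exprn_ge0 ?expR_ge0//; set b := q ^+ _ => ba.
  rewrite mulrA ler_pdivrMr//.
  have := ler_wpM2l (ler0n R K.+1) ba.
  have b0 : 0 <= b by rewrite exprn_ge0 ?expR_ge0.
  rewrite /a [X in _ <= X]mulrC mulfVK ?pnatr_eq0// -natr1 mulrDl mul1r; lra.
apply: (@le_trans _ _ (\sum_(k < K)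
    (\sum_(m < M) x k ^+ m.+1 / m.+1%:R + x k ^+ M / (1 - x k)))).
  by apply: ler_sum => k _; exact: oppr_ln_le_taylor.
rewrite big_split/= addrC lerD//; last exact: main.
apply: le_trans qM.
rewrite mulr_natl -[X in _ *+ X]card_ord -sumr_const; apply: ler_sum => k _.
have xq : x k <= q.
  by rewrite ler_expR lerN2 ler_peMr ?(ltW t0)// ler1n.
case/andP: (x01 k) => xk0 _.
apply: ler_pM.
- by rewrite exprn_ge0.
- by rewrite invr_ge0 ltW.
- by apply: lerXn2r; rewrite ?nnegrE ?expR_ge0.
- by rewrite lef_pV2 ?posrE//; lra.
Qed.

(** * Generating function of families of multisets *)

(** Expanding the product of the geometric series 1 + w x + (w x)^2 + ... gives
    one monomial for each multiset on T, so a finite family of multisets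
    contributes a part of the product. *)
Lemma sum_mset_prod_le (R : realFieldType) (K : choiceType) (T : seq K)
    (w : K -> R) (S : {fset {mset K}%mset}%fset) :
  uniq T -> {in T, forall x, 0 <= w x < 1} ->
  (forall M : {mset K}%mset, M \in S -> forall x, x \in M -> x \in T) ->
  \sum_(M <- S) \prod_(x <- T) w x ^+ M x <= \prod_(x <- T) (1 - w x)^-1.
Proof.
move=> uT w01 ST.
(* With multiplicities at most B the multisets embed into a finite type of
   functions, over which the product of sums can be expanded. *)
pose B := (\max_(M <- S) size (enum_mset M))%N.
have MB (M : {mset K}%mset) x : M \in S -> (M x < B.+1)%N.
  move=> MS; rewrite ltnS (leq_trans _ (leq_bigmax_seq _ MS _))//.
  by rewrite -count_mem_mset count_size.
pose I := 'I_(size T).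
pose t (i : I) : K := tnth (in_tuple T) i.
pose F (f : {ffun I -> 'I_B.+1}) : R := \prod_i w (t i) ^+ f i.
pose mult (M : {mset K}%mset) : {ffun I -> 'I_B.+1} := [ffun i => inord (M (t i))].
have wt i : 0 <= w (t i) < 1 by apply: w01; exact: mem_tnth.
have F0 f : 0 <= F f.
  by apply: prodr_ge0 => i _; rewrite exprn_ge0//; case/andP: (wt i).
have multE M i : M \in S -> mult M i = M (t i) :> nat.
  by move=> MS; rewrite ffunE inordK// MB.
have inj : {in S &, injective mult}.
  move=> M M' MS M'S e; apply/msetP => x.
  have [xT|xT] := boolP (x \in T).
    have [i ->] : exists i, x = t i by apply/tnthP.
    by rewrite -!multE// e.
  have z M0 : M0 \in S -> M0 x = 0%N.
    by move=> M0S; apply/eqP; rewrite mset_eq0; apply: contra xT; exact: ST.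
  by rewrite !z.
rewrite [leLHS](_ : _ = \sum_(f <- [seq mult M | M <- S]) F f); last first.
  rewrite big_map big_seq [RHS]big_seq; apply: eq_bigr => M MS.
  rewrite /F (big_tnth _ _ T); apply: eq_bigr => i _.
  by rewrite multE.
rewrite big_uniq/=; last by rewrite map_inj_in_uniq ?fset_uniq.
apply: (@le_trans _ _ (\sum_f F f)).
  rewrite [leRHS](bigID (mem [seq mult M | M <- S]))/= lerDl.
  by apply: sumr_ge0.
rewrite -(bigA_distr_bigA (fun i (j : 'I_B.+1) => w (t i) ^+ j)).
rewrite (big_tnth _ _ T); apply: ler_prod => i _.
rewrite sum_geometric_le// andbT sumr_ge0// => j _.
by rewrite exprn_ge0//; case/andP: (wt i).
Qed.

Lemma sum_count_mem_le (K : eqType) (f : K -> nat) (T s : seq K) : uniq T ->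
  (\sum_(x <- T) f x * count_mem x s <= \sum_(x <- s) f x)%N.
Proof.
move=> uT; elim: s => [|y s IH].
  by rewrite big_nil big1// => x _; rewrite muln0.
rewrite big_cons; under eq_bigr do rewrite /= mulnDr.
rewrite big_split/= leq_add//.
have [yT|yT] := boolP (y \in T).
  rewrite (bigD1_seq y)//= eqxx muln1 big1 ?addn0// => x xy.
  by rewrite eq_sym (negbTE xy) muln0.
rewrite big_seq big1// => x xT; case: eqP => [e|]; last by rewrite muln0.
by rewrite e xT in yT.
Qed.

(** * From tilings to multisets of bounded area *)

(** Additivity of planar Lebesgue measure on the open rectangles, which lie in
    the interiors of the closed ones. *)
Lemma packing_area_le (R : realType) (m n N : nat)
    (c : 'I_N -> R * R) (d : 'I_N -> nat * nat) :
  (forall i, rect (c i) (d i) `<=` rect (0, 0) (m, n)) ->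
  trivIset setT (fun i => interior (rect (c i) (d i))) ->
  (\sum_(i < N) (d i).1 * (d i).2 <= m * n)%N.
Proof.
move=> sub triv.
pose mu := (@lebesgue_measure R \x @lebesgue_measure R)%E.
pose O (i : 'I_N) : set (R * R) :=
  `](c i).1, (c i).1 + (d i).1%:R[ `*` `](c i).2, (c i).2 + (d i).2%:R[.
have muX (x y : R) (a b : bool) (k l : nat) :
    mu ([set` Interval (BSide a x) (BSide b (x + k%:R))] `*`
        [set` Interval (BSide a y) (BSide b (y + l%:R))]) = (k * l)%:R%:E.
  rewrite /mu product_measure1E//.
  have len (z : R) (j : nat) : lebesgue_measure
      [set` Interval (BSide a z) (BSide b (z + j%:R))] = j%:R%:E.
    rewrite lebesgue_measure_itv/= lte_fin ltrDl ltr0n -EFinD addrAC subrr add0r.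
    by case: j => [|j]//=.
  by rewrite [X in (X * _)%E]len [X in (_ * X)%E]len -EFinM natrM.
have OI i : O i `<=` interior (rect (c i) (d i)).
  case=> x y [/= Ox Oy].
  exists (`](c i).1, (c i).1 + (d i).1%:R[%classic,
          `](c i).2, (c i).2 + (d i).2%:R[%classic).
    by split; apply: open_nbhs_nbhs; split => //; exact: itv_open.
  by case=> u v [/= Ou Ov]; split; apply: subset_itv_oo_cc.
have tO : trivIset setT O.
  move=> i j _ _ [z [/OI zi /OI zj]].
  by apply: triv => //; exists z.
suff : (\sum_(i < N) mu (O i) <= mu (rect (0%R : R, 0%R : R) (m, n)))%E.
  rewrite /rect/= muX.
  under eq_bigr do rewrite muX.
  by rewrite sumEFin lee_fin -natr_sum ler_nat.
rewrite -(measure_bigsetU_ord mu xpredT)//; last first.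
  by move=> i; exact: measurableX.
apply: le_measure; rewrite ?inE.
- by apply: bigsetU_measurable => i _; exact: measurableX.
- by apply: measurableX.
- move=> z; rewrite -bigcup_seq.
  by case=> i _ /OI /interior_subset; exact: sub.
Qed.

(** What is kept of a tiling: the sizes of its rectangles, and the inequality
    between the areas.  The first side of a type is the smaller one, so it is
    at most the width m. *)
Lemma partition_seq (R : realType) (m n : nat) (M : {mset nat * nat}%mset) :
  is_partition R m n M ->
  exists2 s : seq (nat * nat), M = seq_mset s &
    (forall x, x \in s -> [/\ 0 < x.1, x.1 <= m & x.1 <= x.2]%N)
    /\ (\sum_(x <- s) x.1 * x.2 <= m * n)%N.
Proof.
case=> N [c [d [[d0 cover triv] ->]]].
have sub i : rect (c i) (d i) `<=` rect (0, 0) (m, n).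
  by rewrite -cover => z zi; exists i.
exists [seq rect_type (d i) | i <- enum 'I_N] => //; split.
  move=> x /mapP[i _ ->]; have [d1 d2] := d0 i; rewrite /rect_type/=; split.
  - by rewrite leq_min d1 d2.
  - suff : ((d i).1 <= m)%N by move=> ?; rewrite geq_min; apply/orP; left.
    have d1R : 0 <= (d i).1%:R :> R by [].
    have d2R : 0 <= (d i).2%:R :> R by [].
    have /sub : rect (c i) (d i) (c i).
      by split; rewrite /= in_itv/= lexx lerDl.
    have /sub : rect (c i) (d i) ((c i).1 + (d i).1%:R, (c i).2 + (d i).2%:R).
      by split; rewrite /= in_itv/= lexx lerDl andbT.
    case=> /= + _ [/= + _]; rewrite !in_itv/= => /andP[_ h1] /andP[h2 _].
    by rewrite -(ler_nat R); lra.
  - by rewrite /= geq_min !leq_max leqnn.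
rewrite big_map big_enum/=.
rewrite (eq_bigr (fun i => (d i).1 * (d i).2)%N); last first.
  by move=> i _; rewrite /rect_type/=; case: (leqP (d i).1) => // _; rewrite mulnC.
exact: packing_area_le sub triv.
Qed.

(** The weighted counting at the heart of the proof: a partition has total area
    at most m n, so for 0 < q < 1 its monomial, the product of q^area over its
    rectangles, is at least q^(m n). *)
Lemma num_partitions_le_prod (R : realType) (m n : nat) (T : seq (nat * nat))
    (q : R) : 0 < q < 1 -> uniq T ->
  (forall x, x \in T -> 0 < x.1 * x.2)%N ->
  (forall x, [/\ 0 < x.1, x.1 <= m, x.1 <= x.2 & x.1 * x.2 <= m * n]%N -> x \in T) ->
  (num_partitions R m n)%:R * q ^+ (m * n)
    <= \prod_(x <- T) (1 - q ^+ (x.1 * x.2))^-1.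
Proof.
move=> /andP[q0 q1] uT T0 Tall.
pose w (x : nat * nat) : R := q ^+ (x.1 * x.2).
have w01 : {in T, forall x, 0 <= w x < 1}.
  move=> x xT; rewrite /w exprn_ge0 ?(ltW q0)//=.
  by rewrite exprn_ilt1 ?ltW// -lt0n T0.
rewrite /num_partitions; set S := fset_set _.
(* When the set of partitions is infinite S is empty, so that membership in S
   yields a partition in either case. *)
have SP M : M \in S -> is_partition R m n M.
  rewrite /S; have [fin|inf] := pselect (finite_set [set M | is_partition R m n M]).
    by rewrite in_fset_set// inE.
  by rewrite /fset_set; case: pselect.
have ST (M : {mset nat * nat}%mset) : M \in S -> forall x, x \in M -> x \in T.
  move=> /SP /partition_seq[s -> [sT sA]] x.
  rewrite -mset_neq0 mset_seqE => xs.
  have {}xs : x \in s by rewrite -has_pred1 has_count lt0n.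
  apply: Tall; have [x0 x1 x2] := sT _ xs; split=> //.
  apply: leq_trans sA; rewrite (big_rem x)//=; exact: leq_addr.
apply: le_trans (sum_mset_prod_le _ _ _ _ _ uT w01 ST).
rewrite -[X in X%:R]/(size S) -sum1_size natr_sum mulr_suml.
rewrite big_seq [leRHS]big_seq; apply: ler_sum => M MS.
have [s -> [_ sA]] := partition_seq _ _ _ _ (SP M MS).
rewrite mul1r (eq_bigr (fun x => q ^+ (x.1 * x.2 * count_mem x s))); last first.
  by move=> x _; rewrite mset_seqE /w -exprM.
rewrite -expr_sum; apply: ler_wiXn2l; rewrite ?ltW//.
exact: leq_trans (sum_count_mem_le _ _ _ _ uT) sA.
Qed.

(** * Width three *)

(** The types of width at most 3 are (1, k), (2, k) with k >= 2 and (3, k) with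
    k >= 3.  Completing the last two families to all k costs the factors
    (1 - q^2) and (1 - q^3) (1 - q^6), which are at most 2 t, 3 t and 6 t for
    q = e^(-t), and leaves Euler products at the parameters t, 2 t and 3 t, whose
    exponents add up to pi^2 / (6 t) * (1 + 1 / 2 + 1 / 3). *)
Lemma num_partitions3_le (R : realType) (n M0 : nat) (t : R) :
  0 < t -> M0%:R * t <= 1 ->
  (num_partitions R 3 n)%:R <= 36 * t ^+ 3 *
    expR (t * (3 * n)%:R + 11 * pi ^+ 2 / (36 * t)
          - (\sum_(0 <= m < M0) m.+1%:R^-1) / 5).
Proof.
move=> t0 tM0.
(* The second sides run beyond the bound given by the area; additional types
   only enlarge the product. *)
pose K := (3 * n)%N.
pose T := [seq (1%N, k.+1) | k <- iota 0 K] ++ [seq (2%N, k.+2) | k <- iota 0 K]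
  ++ [seq (3%N, k.+3) | k <- iota 0 K].
have uT : uniq T.
  rewrite !cat_uniq !map_inj_uniq ?iota_uniq/=; try by move=> i j [].
  apply/andP; split; last first.
    by rewrite andbT; apply/hasPn => x /mapP[k _ ->]; apply/mapP => -[j _ []].
  apply/hasPn => x; rewrite mem_cat => /orP[] /mapP[k _ ->];
    by apply/mapP => -[j _ []].
have T0 x : x \in T -> (0 < x.1 * x.2)%N.
  by rewrite !mem_cat => /or3P[] /mapP[k _ ->].
have Tall x : [/\ 0 < x.1, x.1 <= 3, x.1 <= x.2 & x.1 * x.2 <= 3 * n]%N -> x \in T.
  case: x => a b /= [a0 a3 ab abn]; rewrite !mem_cat.
  have : ((a == 1) || (a == 2) || (a == 3))%N by lia.
  move=> /orP[/orP[]|] /eqP ea; rewrite ea in ab abn *; apply/or3P.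
  - by apply: Or31; apply/mapP; exists b.-1; [rewrite mem_iota|congr pair]; lia.
  - by apply: Or32; apply/mapP; exists b.-2; [rewrite mem_iota|congr pair]; lia.
  - by apply: Or33; apply/mapP; exists (b - 3)%N; [rewrite mem_iota|congr pair]; lia.
pose q := expR (- t).
have q01 : 0 < q < 1 by rewrite expR_gt0 expR_lt1 oppr_lt0.
have := num_partitions_le_prod R 3 n T q q01 uT T0 Tall.
pose P (a L : nat) := \prod_(k < L) (1 - expR (- (a%:R * t * k.+1%:R)))^-1 : R.
have qE a k : q ^+ (a * k.+1) = expR (- (a%:R * t * k.+1%:R)).
  by rewrite /q -expRM_natl natrM; congr expR; ring.
have q_lt1 a : (0 < a)%N -> q ^+ a < 1.
  by move=> a0; case/andP: q01 => q0 q1; rewrite exprn_ilt1 ?ltW// -lt0n.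
have -> : \prod_(x <- T) (1 - q ^+ (x.1 * x.2))^-1 =
    P 1%N K * ((1 - q ^+ 2) * P 2%N K.+1) * ((1 - q ^+ 3) * (1 - q ^+ 6) * P 3%N K.+2).
  have iotaE (F : nat -> R) : \prod_(k <- iota 0 K) F k = \prod_(k < K) F k.
    by rewrite -(big_mkord xpredT) /index_iota subn0.
  rewrite !big_cat/= !big_map/= !iotaE mulrA /P; congr (_ * _ * _).
  - by apply: eq_bigr => k _; rewrite qE.
  - rewrite big_ord_recl -qE mulVKf; last by rewrite gt_eqF// subr_gt0 q_lt1.
    by apply: eq_bigr => k _; rewrite lift0 qE.
  - rewrite !big_ord_recl -!qE mulrACA mulfV; last by rewrite gt_eqF// subr_gt0 q_lt1.
    rewrite mul1r mulVKf; last by rewrite gt_eqF// subr_gt0 q_lt1.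
    by apply: eq_bigr => k _; rewrite !lift0 qE.
(* This is 1 - e^(-x) <= x at x = a t. *)
have fac a : 0 <= 1 - q ^+ a <= a%:R * t.
  have -> : q ^+ a = expR (- (a%:R * t)) by rewrite /q -expRM_natl mulrN.
  have at0 : 0 <= a%:R * t by rewrite mulr_ge0 ?(ltW t0).
  have := expR_ge1Dx (- (a%:R * t)); have : expR (- (a%:R * t)) <= 1.
    by rewrite expR_le1 oppr_le0.
  by move: (expR _) => z; lra.
have P0 a L : 0 <= P a L.
  by apply: prodr_ge0 => k _; rewrite invr_ge0 subr_ge0 expR_le1 oppr_le0 !mulr_ge0 ?(ltW t0).
have B1 : P 1%N K <= expR (pi ^+ 2 / (6 * t) - (\sum_(0 <= m < M0) m.+1%:R^-1) / 5).
  by rewrite /P mul1r; exact: euler_product_le.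
have Ba a L : (0 < a)%N -> P a L <= expR (pi ^+ 2 / (6 * (a%:R * t))).
  move=> a0; have := @euler_product_le R (a%:R * t) 0 L.
  rewrite mul0r big_geq// mul0r subr0; apply => //.
  by rewrite mulr_gt0 ?ltr0n.
rewrite -ler_pdivlMr ?exprn_gt0 ?expR_gt0// => /le_trans; apply.
have [f20 f2] := andP (fac 2%N); have [f30 f3] := andP (fac 3%N).
have [f60 f6] := andP (fac 6%N).
have -> : (q ^+ (3 * n))^-1 = expR (t * (3 * n)%:R).
  by rewrite /q -expRM_natr mulNr -expRN opprK.
set H := (\sum_(_ <= _ < _) _) / 5 in B1 *.
rewrite [leRHS](_ : _ = expR (pi ^+ 2 / (6 * t) - H)
    * (2%:R * t * expR (pi ^+ 2 / (6 * (2%:R * t))))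
    * (3%:R * t * (6%:R * t) * expR (pi ^+ 2 / (6 * (3%:R * t))))
    * expR (t * (3 * n)%:R)); last first.
  have -> : t * (3 * n)%:R + 11 * pi ^+ 2 / (36 * t) - H =
      (pi ^+ 2 / (6 * t) - H) + pi ^+ 2 / (6 * (2%:R * t))
      + pi ^+ 2 / (6 * (3%:R * t)) + t * (3 * n)%:R.
    by field; rewrite gt_eqF.
  rewrite !expRD; ring.
rewrite ler_pM2r ?expR_gt0//.
have pf a : 0 <= 1 - q ^+ a by case/andP: (fac a).
apply: ler_pM; [by rewrite !mulr_ge0|by rewrite !mulr_ge0| |].
  apply: ler_pM; [by []|by rewrite mulr_ge0|by []|].
  by apply: ler_pM => //; exact: Ba.
apply: ler_pM => //; first by rewrite mulr_ge0.
  exact: ler_pM.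
exact: Ba.
Qed.

Lemma harmonic_unbounded (R : realType) (A : R) :
  exists N, A <= \sum_(0 <= m < N) m.+1%:R^-1.
Proof.
have nd : nondecreasing_seq (series (@harmonic R)).
  by apply: nondecreasing_series => k _ _; exact: harmonic_ge0.
have /cvgryPge/(_ A)[N _ HN] := nondecreasing_dvgn_lt nd (@dvg_harmonic R).
by exists N; exact: HN (leqnn N).
Qed.

(** Optimize num_partitions3_le at t = 11 pi / (18 s) with
    s = sqrt (11 n / 3): both 3 n t and 11 pi^2 / (36 t) equal pi s / 2.  Then
    t <= 2 / sqrt n gives 36 t^3 <= 288 n^(-3/2), and the number M0 of harmonic
    terms is chosen so that they absorb the constant 288 * 432 / 11; n must
    be large enough for M0 t <= 1. *)
Lemma num_partitions3_near_le (R : realType) : \forall n \near \oo,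
  (num_partitions R 3 n)%:R <=
    11 / 432 * n%:R `^ (- (3 / 2)) * expR (pi * Num.sqrt (11 * n%:R / 3)) :> R.
Proof.
(* 288 = 36 * 8 is the constant reached without the harmonic correction and
   11 / 432 the one to be reached. *)
pose C : R := 288 * 432 / 11.
have [M0 HM0] := harmonic_unbounded R (5 * C).
near=> n.
have nge : (4 * M0 ^ 2 + 1 <= n)%N by near: n; exact: nbhs_infty_ge.
have n0 : 0 < n%:R :> R by rewrite ltr0n; lia.
pose r := Num.sqrt n%:R : R.
have r0 : 0 < r by rewrite sqrtr_gt0.
have rr : r ^+ 2 = n%:R by rewrite sqr_sqrtr// ltW.
pose s := Num.sqrt (11 * n%:R / 3) : R.
have s0 : 0 < s by rewrite sqrtr_gt0; lra.
have ss : s ^+ 2 = 11 * n%:R / 3 by rewrite sqr_sqrtr//; lra.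
have p0 := pi_gt0 R.
have p4 : pi < 4 :> R by have := pihalf_lt2 R; lra.
pose t := 11 * pi / (18 * s) : R.
have t0 : 0 < t by rewrite divr_gt0 ?mulr_gt0.
(* s / r is the square root of 11 / 3, and 3 / 2 is a convenient lower bound. *)
have sr : 3 / 2 * r <= s by nra.
have ts : t * (18 * s) = 11 * pi by rewrite /t mulfVK// gt_eqF// mulr_gt0.
have tr : t * r <= 2 by have := ler_wpM2l (ltW t0) sr; lra.
have tM0 : M0%:R * t <= 1.
  have M0r : 2 * M0%:R <= r.
    rewrite -(@ler_pXn2r _ 2) ?nnegrE ?mulr_ge0 ?(ltW r0)// rr.
    by rewrite -natrM -natrX ler_nat expnMn; lia.
  by have := ler_wpM2r (ltW t0) M0r; lra.
apply: le_trans (num_partitions3_le R n M0 t t0 tM0) _.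
have -> : t * (3 * n)%:R + 11 * pi ^+ 2 / (36 * t) = pi * s.
  have -> : t * (3 * n)%:R = pi * s / 2.
    rewrite natrM; have -> : n%:R = 3 * s ^+ 2 / 11 :> R by rewrite ss; field.
    by rewrite /t; field; rewrite gt_eqF.
  have -> : 11 * pi ^+ 2 / (36 * t) = pi * s / 2.
    rewrite /t; move: (pi : R) p0 => p p0.
    by field; rewrite !gt_eqF.
  by field.
rewrite -/s expRD mulrA.
have -> : n%:R `^ (- (3 / 2)) = (r ^+ 3)^-1.
  rewrite powRN (_ : 3 / 2 = 1 + 2^-1); last by field.
  rewrite powRD ?(gt_eqF n0) ?implybT// (powRr1 (ltW n0)) (powR12_sqrt (ltW n0)).
  by rewrite -/r -rr -exprSr.
rewrite mulrAC ler_pM2r ?expR_gt0//.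
have t3 : t ^+ 3 <= 8 * (r ^+ 3)^-1.
  rewrite ler_pdivlMr ?exprn_gt0// -exprMn.
  have -> : 8 = 2 ^+ 3 :> R by rewrite -natrX.
  by apply: lerXn2r tr; rewrite nnegrE ?ler0n// mulr_ge0 ?ltW.
have eC : expR (- ((\sum_(0 <= m < M0) m.+1%:R^-1) / 5)) <= C^-1.
  rewrite expRN lef_pV2 ?posrE ?expR_gt0//; last by rewrite /C; lra.
  apply: le_trans (expR_ge1Dx _); rewrite ler_wpDl// ler_pdivlMr//.
  by rewrite mulrC.
apply: (@le_trans _ _ (36 * (8 * (r ^+ 3)^-1) * C^-1)).
  apply: ler_pM => //; [|by rewrite ler_pM2l].
  by rewrite mulr_ge0 ?exprn_ge0 ?(ltW t0).
by rewrite le_eqVlt; apply/orP; left; apply/eqP; rewrite /C; field; rewrite gt_eqF.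
Unshelve. all: by end_near.
Qed.

Theorem theorem1p8 (R : realType) :
  (exists e : nat -> R^o, e =o_\oo (fun=> 1 : R^o) /\
     \forall n \near \oo,
       (num_partitions R 3 n)%:R <=
         11 / 432 * n%:R `^ (- (3 / 2)) *
         expR (pi * Num.sqrt (11 * n%:R / 3)) * (1 + e n)) /\
  (exists e : nat -> R^o, e =o_\oo (fun n => Num.sqrt n%:R : R^o) /\
     \forall n \near \oo,
       (num_partitions R 3 n)%:R <=
         expR (pi * Num.sqrt (11 * n%:R / 3) + e n)).
Proof.
split; exists (fun=> 0); split.
- apply/eqoP => eps eps0; apply: nearW => n.
  by rewrite normr0 mulr_ge0// ltW.
- near=> n; rewrite addr0 mulr1.
  by near: n; exact: num_partitions3_near_le.
- apply/eqoP => eps eps0; apply: nearW => n.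
  by rewrite normr0 mulr_ge0// ltW.
near=> n; rewrite addr0.
apply: (@le_trans _ _ (11 / 432 * n%:R `^ (- (3 / 2)) *
         expR (pi * Num.sqrt (11 * n%:R / 3)))).
  by near: n; exact: num_partitions3_near_le.
rewrite ler_piMl ?expR_ge0//.
have n1 : 1 <= n%:R :> R by rewrite ler1n; near: n; exact: nbhs_infty_ge.
have : n%:R `^ (- (3 / 2)) <= 1 :> R.
  rewrite -[leRHS](powRr0 n%:R); apply: ler_powR => //; lra.
by have := powR_ge0 (n%:R : R) (- (3 / 2)); lra.
Unshelve. all: by end_near.
Qed.
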